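(* Let $n\ge2$, let $\Omega\subset\mathbb{R}^{n-1}$ be a bounded simply connected domain with smooth boundary, and let $b(y,\omega)$ be a stationary random shear process with almost surely continuous sample paths satisfying $E[\|b\|_\infty]<\infty$. Then the amplified shear field $\delta\,b(y,\omega)$ generates average front speed satisfying $$E\big[|c^*(\delta,\omega)|\big]=O(\delta),\qquad \delta\gg1\ (\delta\to\infty).$$ Moreover, $\lim_{\delta\to\infty}E\big[|c^*(\delta,\omega)|\big]/\delta$ exists.
   Context: Here $f(u)=u(1-u)$ (so $f'(0)=1$), and $\|b\|_\infty=\sup_{y\in\overline\Omega}|b(y,\omega)|$. For each realization $\omega$ and each $\delta\geq0$, the KPP minimal front speed $c^*(\delta,\omega)$ for the shear $\delta b$ is $$c^*(\delta,\omega)=\inf_{\lambda>0}\frac{\mu(\lambda)}{\lambda},$$ where $\mu(\lambda)=\mu(\lambda,\delta,\omega)$ is the principal eigenvalue (the one with a positive eigenfunction $\phi>0$) of $$\Delta_y\phi+[\lambda^2+\lambda\,\delta\,b(y,\omega)+f'(0)]\phi=\mu(\lambda)\phi\ \text{ in }\Omega,\qquad\frac{\partial\phi}{\partial\nu}=0\ \text{ on }\partial\Omega,$$ $\nu$ being the unit outward normal. (This is the speed of fronts of $u_t=\Delta_{x,y}u+\delta b(y,\omega)u_x+f(u)$ in $\mathbb{R}\times\Omega$ with zero Neumann condition on $\mathbb{R}\times\partial\Omega$.) *)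

(* Defs.v *)
From HB Require Import structures.
From mathcomp Require Import all_boot all_order all_algebra.
From mathcomp Require Import all_classical all_reals all_analysis.

Set Implicit Arguments.
Unset Strict Implicit.
Unset Printing Implicit Defensive.
Import Order.TTheory GRing.Theory Num.Theory.
Import numFieldNormedType.Exports.
Local Open Scope classical_set_scope.
Local Open Scope ring_scope.

(* Row vectors carry the sigma-algebra generated by the coordinates, as tuples
   do in the library; over the reals it is the Borel sigma-algebra. *)
Definition rV_display : measure_display -> measure_display.
Proof. exact. Qed.

Section measurable_rV.
Context {d} {T : sigmaRingType d}.
Variable m : nat.

Let coors : 'I_m -> 'rV[T]_m -> T := fun i v => v ord0 i.

Let rV_set0 : g_sigma_preimage coors set0.
Proof. exact: sigma_algebra0. Qed.

Let rV_setC A : g_sigma_preimage coors A -> g_sigma_preimage coors (~` A).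
Proof. exact: sigma_algebraC. Qed.

Let rV_bigcup (F : (set 'rV[T]_m)^nat) :
  (forall i, g_sigma_preimage coors (F i)) ->
  g_sigma_preimage coors (\bigcup_i (F i)).
Proof. exact: sigma_algebra_bigcup. Qed.

HB.instance Definition _ := @isMeasurable.Build (rV_display d)
  'rV[T]_m (g_sigma_preimage coors) rV_set0 rV_setC rV_bigcup.

End measurable_rV.

Section lebesgue_rV.
Context {R : realType}.

Definition cons_rV m (p : measurableTypeR R * 'rV[measurableTypeR R]_m) :
    'rV[measurableTypeR R]_m.+1 :=
  \row_(i < m.+1) if unlift ord0 i is Some j then p.2 ord0 j else p.1.

Lemma measurable_coord_rV m (i : 'I_m) :
  measurable_fun [set: 'rV[measurableTypeR R]_m] (fun v => v ord0 i).
Proof.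
move=> _ Y mY; rewrite setTI; apply: sub_sigma_algebra => /=.
rewrite -bigcup_seq/=; exists i => /=; first by rewrite mem_index_enum.
by exists Y => //; rewrite setTI.
Qed.

Lemma measurable_fun_rV d (S : measurableType d) m
    (f : S -> 'rV[measurableTypeR R]_m) :
  (forall i, measurable_fun setT (fun s => f s ord0 i)) ->
  measurable_fun setT f.
Proof.
move=> mf; apply: (@measurability _ _ _ _ _ _
  (\big[setU/set0]_(i < m) preimage_set_system setT
     (fun v : 'rV[measurableTypeR R]_m => v ord0 i) measurable)) => //.
move=> _ [A + <-]; rewrite -bigcup_seq => -[i _ [B mB <-]].
rewrite !setTI -[X in measurable X]setTI.
exact: (mf i measurableT B mB).
Qed.

Lemma measurable_cons_rV m : measurable_fun setT (@cons_rV m).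
Proof.
apply: measurable_fun_rV => i; case: (unliftP ord0 i) => [j ->|->].
  rewrite [X in measurable_fun _ X](_ : _ =
      (fun v : 'rV[measurableTypeR R]_m => v ord0 j) \o snd).
    exact: measurableT_comp (@measurable_coord_rV m j) measurable_snd.
  by apply/funext => p; rewrite mxE liftK.
rewrite [X in measurable_fun _ X](_ : _ = fst); first exact: measurable_fst.
by apply/funext => p; rewrite mxE unlift_none.
Qed.

Section step.
Variables (m : nat).
Variable mu : {sigma_finite_measure set 'rV[measurableTypeR R]_m -> \bar R}.

Definition lebesgue_step : set 'rV[measurableTypeR R]_m.+1 -> \bar R :=
  pushforward (lebesgue_measure \x mu)%E (@cons_rV m).

Let step0 : lebesgue_step set0 = 0%E.
Proof. by rewrite /lebesgue_step /pushforward preimage_set0 measure0. Qed.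

Let step_ge0 A : (0 <= lebesgue_step A)%E.
Proof. by rewrite /lebesgue_step /pushforward measure_ge0. Qed.

Let mpre A : measurable A -> measurable (@cons_rV m @^-1` A).
Proof.
by move=> mA; rewrite -[X in measurable X]setTI; exact: measurable_cons_rV.
Qed.

Let step_sigma_additive : semi_sigma_additive lebesgue_step.
Proof.
move=> F mF tF mUF; rewrite /lebesgue_step /pushforward preimage_bigcup.
apply: measure_semi_sigma_additive.
- by move=> n; exact: mpre.
- apply/trivIsetP => /= i j _ _ ij; rewrite -preimage_setI.
  by move/trivIsetP : tF => /(_ _ _ _ _ ij) ->//; rewrite preimage_set0.
- by rewrite -preimage_bigcup; exact: mpre.
Qed.

HB.instance Definition _ := isMeasure.Build _ _ _ lebesgue_step
  step0 step_ge0 step_sigma_additive.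

Let step_sigma_finite : sigma_finite setT lebesgue_step.
Proof.
have /sigma_finiteP[F [TF ndF Foo]] := sigma_finiteT (@lebesgue_measure R).
have /sigma_finiteP[G [TG ndG Goo]] := sigma_finiteT mu.
pose tl (v : 'rV[measurableTypeR R]_m.+1) : 'rV[measurableTypeR R]_m :=
  \row_j v ord0 (lift ord0 j).
have mhd : measurable_fun setT (fun v : 'rV[measurableTypeR R]_m.+1 => v ord0 ord0).
  exact: measurable_coord_rV.
have mtl : measurable_fun setT tl.
  apply: measurable_fun_rV => i; rewrite [X in measurable_fun _ X](_ : _ =
    (fun v : 'rV[measurableTypeR R]_m.+1 => v ord0 (lift ord0 i))).
    exact: measurable_coord_rV.
  by apply/funext => v; rewrite mxE.
exists (fun n => ((fun v : 'rV[measurableTypeR R]_m.+1 => v ord0 ord0) @^-1` F n)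
                 `&` (tl @^-1` G n)).
  apply/esym; rewrite -subTset => v _.
  have : [set: measurableTypeR R] (v ord0 ord0) by [].
  rewrite TF => -[i _ Fi]; have : [set: 'rV[measurableTypeR R]_m] (tl v) by [].
  rewrite TG => -[j _ Gj]; exists (maxn i j) => //; split.
    by have /subsetPset := ndF _ _ (leq_maxl i j); exact.
  by have /subsetPset := ndG _ _ (leq_maxr i j); exact.
move=> k; have [mF Fk] := Foo k; have [mG Gk] := Goo k; split.
  by apply: measurableI; rewrite -[X in measurable X]setTI; [exact: mhd|exact: mtl].
rewrite /lebesgue_step /pushforward (_ : _ @^-1` _ = F k `*` G k).
  rewrite product_measure1E// lte_mul_pinfty//.
  by rewrite ge0_fin_numE.
have hdE p : @cons_rV m p ord0 ord0 = p.1 by rewrite mxE unlift_none.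
have tlE p : tl (@cons_rV m p) = p.2.
  by apply/rowP => j; rewrite !mxE liftK.
by apply/seteqP; split => p; rewrite /preimage/= hdE tlE.
Qed.

HB.instance Definition _ := Measure_isSigmaFinite.Build _ _ _ lebesgue_step
  step_sigma_finite.

End step.

Fixpoint lebesgue_rV m :
    {sigma_finite_measure set 'rV[measurableTypeR R]_m -> \bar R} :=
  if m is m'.+1 then lebesgue_step (lebesgue_rV m')
  else @dirac _ 'rV[measurableTypeR R]_0 0 R.

Lemma lebesgue_rV_box m (B : 'I_m -> set (measurableTypeR R)) :
  (forall i, measurable (B i)) ->
  lebesgue_rV m [set v | forall i, B i (v ord0 i)] =
  (\prod_(i < m) lebesgue_measure (B i))%E.
Proof.
elim: m B => [|m IHm] B mB.
  rewrite big_ord0 /= diracE mem_set//=.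
  by case.
rewrite big_ord_recl.
pose C : set 'rV[measurableTypeR R]_m :=
  [set v | forall i, B (lift ord0 i) (v ord0 i)].
transitivity ((lebesgue_measure \x lebesgue_rV m)%E (B ord0 `*` C)).
  rewrite /= /lebesgue_step /pushforward; congr (_ _).
  apply/seteqP; split => p /=.
    move=> Bp; split; first by have := Bp ord0; rewrite mxE unlift_none.
    by move=> i /=; have := Bp (lift ord0 i); rewrite mxE liftK.
  by move=> [/= B0 B1] i; rewrite mxE; case: (unliftP ord0 i) => [j ->|->].
have mC : measurable C.
  rewrite (_ : C = \bigcap_i
      ((fun v : 'rV[measurableTypeR R]_m => v ord0 i) @^-1` B (lift ord0 i))).
    apply: fin_bigcap_measurable => [|i _]; first exact: finite_finset.
    rewrite -[X in measurable X]setTI.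
    exact: measurable_coord_rV.
  by apply/seteqP; split => v /= Bv i; [move=> _|]; exact: Bv.
by rewrite product_measure1E//; congr (_ * _)%E; exact: IHm.
Qed.

End lebesgue_rV.

Section smooth.
Context {R : realType} {m : nat}.
Implicit Types (f : 'rV[R]_m -> R) (y : 'rV[R]_m).

Definition partial (i : 'I_m) f y : R := 'D_('e_i) f y.

Fixpoint continuously_differentiable (k : nat) f : Prop :=
  continuous f /\
  if k is k'.+1 then
    (forall i y, derivable f y 'e_i) /\
    (forall i, continuously_differentiable k' (partial i f))
  else True.

Definition smooth f := forall k, continuously_differentiable k f.

Definition test_function (Omega : set 'rV[R]_m) f :=
  smooth f /\
  exists K, [/\ compact K, K `<=` Omega & forall y, ~ K y -> f y = 0].

End smooth.

Section domains.
Context {R : realType} {m : nat}.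
Implicit Types Omega : set 'rV[R]_m.

Definition domain Omega := [/\ Omega !=set0, open Omega & connected Omega].

(* Every loop in Omega is contracted by a homotopy with fixed base point. *)
Definition simply_connected Omega :=
  forall gamma : R -> 'rV[R]_m,
    {within `[0, 1], continuous gamma} -> gamma @` `[0, 1] `<=` Omega ->
    gamma 0 = gamma 1 ->
  exists H : R * R -> 'rV[R]_m,
    [/\ {within `[0, 1] `*` `[0, 1], continuous H},
        H @` (`[0, 1] `*` `[0, 1]) `<=` Omega,
        forall t, t \in `[0, 1] -> H (0, t) = gamma t /\ H (1, t) = gamma 0 &
        forall s, s \in `[0, 1] -> H (s, 0) = gamma 0 /\ H (s, 1) = gamma 0].

(* Local defining functions: near each boundary point, Omega is {rho < 0} with
   rho smooth and of nonzero gradient. *)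
Definition smooth_boundary Omega :=
  forall p, (closure Omega `\` Omega) p ->
  exists (U : set 'rV[R]_m) (rho : 'rV[R]_m -> R),
    [/\ open U, U p, smooth rho, exists i, partial i rho p != 0 &
        forall y, U y -> (Omega y <-> rho y < 0)].

End domains.

Section neumann.
Context {R : realType} {m : nat}.
Variable Omega : set 'rV[R]_m.
Implicit Types (f h phi psi V : 'rV[R]_m -> R) (G K : 'rV[R]_m -> 'rV[R]_m).

Local Notation leb := (@lebesgue_rV R m).

Definition L2 f :=
  measurable_fun (Omega : set 'rV[measurableTypeR R]_m) f /\
  (\int[leb]_(y in Omega) (f y ^+ 2)%:E < +oo)%E.

(* f belongs to the Sobolev space H^1(Omega) and G is its weak gradient. *)
Definition H1 f G :=
  L2 f /\ forall i, L2 (fun y => G y ord0 i) /\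
    forall chi, test_function Omega chi ->
      \int[leb]_(y in Omega) (f y * partial i chi y) =
      - \int[leb]_(y in Omega) (G y ord0 i * chi y).

(* [neumann_laplacian phi h]: Delta phi = h in Omega and d phi / d nu = 0 on
   the boundary, in the usual weak sense: by Green's formula, the boundary
   condition is carried by the test functions psi not vanishing there. *)
Definition neumann_laplacian phi h :=
  L2 h /\ exists2 G, H1 phi G &
    forall psi K, H1 psi K ->
      \int[leb]_(y in Omega) (h y * psi y) =
      - \int[leb]_(y in Omega) (\sum_i G y ord0 i * K y ord0 i).

(* Delta phi + V phi = mu phi with the Neumann condition and phi > 0. The weak
   sense is needed because V is only continuous, so that phi may fail to have
   classical second derivatives. *)
Definition principal_eigenvalue V (mu : R) :=
  exists2 phi, (forall y, Omega y -> 0 < phi y) &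
    neumann_laplacian phi (fun y => mu * phi y - V y * phi y).

End neumann.

Section random_shear.
Context {R : realType} {d : measure_display} {T : measurableType d}.
Context {P : probability T R} {m : nat}.

(* The joint laws are invariant under translations that stay in D. *)
Definition stationary (D : set 'rV[R]_m) (b : 'rV[R]_m -> {RV P >-> R}) :=
  forall (k : nat) (y : 'I_k -> 'rV[R]_m) (h : 'rV[R]_m),
    (forall i, D (y i) /\ D (y i + h)) ->
  forall A : set (k.-tuple (measurableTypeR R)), measurable A ->
    P [set w | A [tuple (b (y i + h) w : measurableTypeR R) | i < k]] =
    P [set w | A [tuple (b (y i) w : measurableTypeR R) | i < k]].

Definition continuous_path (D : set 'rV[R]_m) (b : 'rV[R]_m -> {RV P >-> R})
  (w : T) := {within D, continuous (fun y => b y w)}.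

Definition sup_norm (D : set 'rV[R]_m) (b : 'rV[R]_m -> {RV P >-> R})
  (w : T) : \bar R := ereal_sup [set `|b y w|%:E | y in D].

End random_shear.

Definition kpp {R : realType} (u : R) : R := u * (1 - u).

(* [inf] is the infimum of a nonempty set bounded below: a principal eigenvalue
   mu(lambda) of the shear problem is at least
   lambda^2 - lambda * delta * ||b|| + 1. *)
Definition front_speed {R : realType} (mu : R -> R) : R :=
  inf [set mu lambda / lambda | lambda in [set l | 0 < l]].

(* Main.v *)
Require Import Defs.
From HB Require Import structures.
From mathcomp Require Import all_boot all_order all_algebra.
From mathcomp Require Import all_classical all_reals all_analysis.
From mathcomp Require Import measurable_realfun ring lra.

Set Implicit Arguments.
Unset Strict Implicit.
Unset Printing Implicit Defensive.
Import Order.TTheory GRing.Theory Num.Theory.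
Import numFieldNormedType.Exports.
Local Open Scope classical_set_scope.
Local Open Scope ring_scope.

(** Two weak solutions may be tested against each other. If [phi1] and [phi2]
    are positive Neumann eigenfunctions for the potentials [V1], [V2] and the
    eigenvalues [mu1], [mu2], the two gradient terms are the same by symmetry,
    whence
      integral of (mu1 - mu2 - (V1 - V2)) phi1 phi2 = 0,
    and positivity forces mu1 - mu2 <= sup (V1 - V2)
    ([principal_eigenvalue_le]). This comparison is the only property of
    principal eigenvalues that the proof uses, and it has three consequences.

    - The speed is Lipschitz in the shear: two shears at sup distance e have
      speeds at distance at most e ([eigenvalue_dist_le],
      [front_speed_dist_le]). Comparing with the zero shear gives
      |c*(delta)| <= a + delta ||b|| with a deterministic constant a.

    - The speed is a measurable function of the realization. The continuous
      functions on a compact set form a separable space for the sup norm, so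
      the probability space splits into countably many measurable pieces on
      each of which the path of the shear, hence the speed, hardly varies
      ([measurable_fun_path_lipschitz]).

    - The eigenvalue is mu(lambda) = lambda^2 + nu(lambda delta), where nu does
      not depend on delta. With s = lambda delta, the ratio becomes
      c*(delta) / delta = inf over s > 0 of (s / delta^2 + nu(s) / s)
      ([front_speed_rescaled]). Where this infimum is finite it decreases in
      delta, and by the bound above it converges for each realization
      ([cvg_inf_penalized]).

    Dominated convergence, with dominating function |a| + ||b||, then yields
    the limit of E|c*| / delta ([cvg_expectation_ratio]), and the bound O(delta)
    follows from the existence of a finite limit.

    The infimum of a set of reals that is not bounded below is 0 by convention.
    The lemmas on infima below hold with this convention, so the sign of nu(0)
    never has to be determined. *)

(** * Infima of families of real numbers *)

Section infima.
Context {R : realType}.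

Lemma has_lbound_image_shift (I : Type) (A : set I) (f g : I -> R) (L : R) :
  (forall i, A i -> g i <= f i + L) ->
  has_lbound (g @` A) -> has_lbound (f @` A).
Proof.
move=> gf [m gm]; exists (m - L) => _ [i Ai <-].
by rewrite lerBlDr (le_trans _ (gf _ Ai))//; apply: gm; exists i.
Qed.

Lemma inf_image_le_shift (I : Type) (A : set I) (f g : I -> R) (L : R) :
  A !=set0 -> has_lbound (f @` A) ->
  (forall i, A i -> f i <= g i + L) -> inf (f @` A) <= inf (g @` A) + L.
Proof.
move=> A0 fb fg; rewrite -lerBlDr; apply: lb_le_inf.
  by case: A0 => i Ai; exists (g i), i.
move=> _ [i Ai <-]; rewrite lerBlDr (le_trans _ (fg _ Ai))//.
by apply: ge_inf => //; exists i.
Qed.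

(** If one family is unbounded below then so is the other one, and both infima
    take the same conventional value; this is why no lower bound is assumed. *)
Lemma dist_inf_image_le (I : Type) (A : set I) (f g : I -> R) (L : R) :
  A !=set0 -> (forall i, A i -> `|f i - g i| <= L) ->
  `|inf (f @` A) - inf (g @` A)| <= L.
Proof.
move=> A0 fgL.
have L0 : 0 <= L by case: A0 => i /fgL; apply: le_trans.
have fg i : A i -> f i <= g i + L.
  by move=> /fgL; rewrite ler_distl => /andP[_]; rewrite addrC.
have gf i : A i -> g i <= f i + L.
  by move=> /fgL; rewrite ler_distl => /andP[+ _]; rewrite lerBlDr.
have [fb|fb] := pselect (has_lbound (f @` A)).
  have gb := has_lbound_image_shift fg fb.
  rewrite ler_distl lerBlDr.
  by rewrite !inf_image_le_shift.
have gb : ~ has_lbound (g @` A) by move/(has_lbound_image_shift gf).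
by rewrite !inf_out ?subrr ?normr0// => -[].
Qed.

(** Lowering the weight [t ^- 2] of the penalization lowers the infimum. Should
    the family be unbounded below for one [t0], it stays so for [t >= t0], and
    the infimum is eventually constant. *)
Lemma cvg_inf_penalized (k : R -> R) (M : R) :
  (forall t, 1 <= t ->
     `|inf [set s / t ^+ 2 + k s | s in [set s | 0 < s]]| <= M) ->
  exists l : R,
    inf [set s / t ^+ 2 + k s | s in [set s | 0 < s]] @[t --> +oo] --> l.
Proof.
set pos := [set s : R | 0 < s]; move=> gM.
pose F t s := s / t ^+ 2 + k s; pose g t := inf (F t @` pos).
have pos0 : pos !=set0 by exists 1; rewrite /pos /=.
have FF t u s : 1 <= t -> t <= u -> pos s -> F u s <= F t s + 0.
  move=> t1 tu /= s0; rewrite addr0 lerD2r ler_pM2l// lef_pV2 ?posrE.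
  - by rewrite lerXn2r// nnegrE; lra.
  - by rewrite exprn_gt0//; lra.
  - by rewrite exprn_gt0//; lra.
have [bd|/existsNP[t0 /not_implyP[t01 nbd]]] :=
    pselect (forall t, 1 <= t -> has_lbound (F t @` pos)); last first.
  exists 0; apply: (@cvg_near_cst _ _ 0).
  near=> t.
  have t0t : t0 <= t by near: t; apply: nbhs_pinfty_ge; rewrite num_real.
  rewrite -/(F t) inf_out// => -[_]; apply: contra_not nbd.
  by apply: (@has_lbound_image_shift _ _ _ _ 0) => s /FF; exact.
have gdec t u : 1 <= t -> t <= u -> g u <= g t.
  move=> t1 tu; rewrite -[leRHS]addr0.
  apply: inf_image_le_shift => //; last by move=> s; exact: FF.
  by apply: bd; lra.
pose G := g @` [set t | 1 <= t].
have G0 : G !=set0 by exists (g 1), 1 => /=.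
have Gb : has_lbound G.
  by exists (- M) => _ [t t1 <-]; have := gM _ t1; rewrite ler_norml => /andP[].
exists (inf G); apply/cvgrPdist_le => e e0.
have [_ [t0 t01 <-] gt0] := @inf_adherent _ G e e0 (conj G0 Gb).
near=> t.
have tt0 : t0 <= t by near: t; apply: nbhs_pinfty_ge; rewrite num_real.
rewrite -/(F t) -/(g t) distrC ger0_norm ?subr_ge0; last first.
  by apply: ge_inf => //; exists t => //=; rewrite (le_trans t01).
by rewrite lerBlDl (le_trans (gdec _ _ t01 tt0))// ltW.
Unshelve. all: by end_near. Qed.

End infima.

Lemma inf_image_pM (R : realType) (I : Type) (A : set I) (f : I -> R) (c : R) :
  0 < c -> A !=set0 -> inf ((fun i => c * f i) @` A) = c * inf (f @` A).
Proof.
move=> c0 A0.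
have lb (g h : I -> R) (a : R) : 0 < a -> (forall i, h i = a * g i) ->
    has_lbound (g @` A) -> has_lbound (h @` A) /\ a * inf (g @` A) <= inf (h @` A).
  move=> a0 hg gb.
  have lbd : lbound (h @` A) (a * inf (g @` A)).
    move=> _ [i Ai <-]; rewrite hg ler_pM2l//.
    by apply: ge_inf => //; exists i.
  split; first by exists (a * inf (g @` A)).
  by apply: lb_le_inf => //; case: A0 => i Ai; exists (h i), i.
have fE i : f i = c^-1 * (c * f i) by rewrite mulKf// gt_eqF.
have ci : 0 < c^-1 by rewrite invr_gt0.
have [fb|fb] := pselect (has_lbound (f @` A)); last first.
  rewrite !inf_out ?mulr0//; first by case.
  by case=> _ /(lb _ f _ ci fE)[].
have [cfb le1] := lb f (fun i => c * f i) _ c0 (fun=> erefl) fb.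
have [_ le2] := lb _ f _ ci fE cfb.
apply/eqP; rewrite eq_le le1 andbT.
by rewrite -ler_pdivrMl.
Qed.

(** * Integrals of functions that are not known to be measurable *)

Section lower_integral.
Import HBNNSimple.
Context d (T : measurableType d) (R : realType).
Variable mu : {measure set T -> \bar R}.
Local Open Scope ereal_scope.

(** The integral of a nonnegative function is by definition a supremum over
    simple functions below it, which makes it monotone without measurability.
    This matters because the speed is only controlled on the event that the
    paths are continuous, and it may be arbitrary on the null set left. *)
Lemma ge0_le_integral_lower (f g : T -> \bar R) :
  (forall x, 0 <= f x) -> (forall x, f x <= g x) ->
  \int[mu]_x f x <= \int[mu]_x g x.
Proof.
move=> f0 fg; have g0 x : 0 <= g x by exact: le_trans (fg x).
rewrite !ge0_integralTE//; apply: ereal_sup_le => _ [h hf <-].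
by exists h => // x; exact: le_trans (fg x).
Qed.

Lemma ge0_integral_null_setC (N : set T) (f : T -> \bar R) :
  measurable N -> mu N = 0 -> (forall x, 0 <= f x) ->
  \int[mu]_x f x = \int[mu]_(x in ~` N) f x.
Proof.
move=> mN N0 f0; rewrite [RHS]integral_mkcond.
have r0 (h : T -> \bar R) : (forall x, 0 <= h x) -> forall x, 0 <= (h \_ (~` N)) x.
  by move=> h0 x; rewrite patchE; case: ifP.
apply/eqP; rewrite eq_le; apply/andP; split; last first.
  by apply: ge0_le_integral_lower => [|x]; [exact: r0|rewrite patchE; case: ifP].
rewrite [leLHS]ge0_integralTE//; apply: ge_ereal_sup => _ [h hf <-].
have h0 x : 0 <= (EFin \o h) x by rewrite lee_fin.
rewrite -integralT_nnsfun.
have mh : measurable_fun setT (fun x => (h x)%:E).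
  exact/measurable_EFinP/measurable_funP.
have -> : \int[mu]_x (h x)%:E = \int[mu]_x ((EFin \o h) \_ (~` N)) x.
  rewrite (ge0_negligible_integral mN)//; last by move=> x _; exact: h0.
  by rewrite setTD integral_mkcond.
apply: ge0_le_integral_lower => x; first exact: r0.
by rewrite !patchE; case: ifP => // _; exact: hf.
Qed.

End lower_integral.

(** * Measurability by small oscillation *)

(** The sublevel set [F < a] is the union, over a sequence of precisions, of
    those pieces of the corresponding cover that it contains. *)
Lemma measurable_fun_small_oscillation d (T : measurableType d) (R : realType)
    (G : set T) (F : T -> R) :
  measurable G ->
  (forall e : R, 0 < e -> exists (I : countType) (A : I -> set T),
     [/\ forall i, measurable (A i), G `<=` \bigcup_i A i &
         forall i w w', (G `&` A i) w -> (G `&` A i) w' -> F w <= F w' + e]) ->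
  measurable_fun G F.
Proof.
move=> mG cover.
have lower a : measurable (G `&` [set w | F w < a]).
  have step k : {B : set T | [/\ measurable B, B `<=` [set w | F w < a] &
      G `&` [set w | F w + k.+1%:R^-1 < a] `<=` B]}.
    apply: cid.
    have [I [A [mA GA oscA]]] := cover k.+1%:R^-1 ltac:(by []).
    pose C i := if `[< G `&` A i `<=` [set w | F w < a] >] then G `&` A i else set0.
    exists (\bigcup_i C i); split.
    - apply: countable_bigcupT_measurable => [|i]; first exact: countableP.
      by rewrite /C; case: asboolP => // ?; exact: measurableI.
    - by move=> w [i _]; rewrite /C; case: asboolP => // CA; exact: CA.
    - move=> w [Gw /= Fw]; have [i _ Aiw] := GA _ Gw; exists i => //.
      rewrite /C; case: asboolP => // -[] w' GAw'; apply: le_lt_trans Fw.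
      exact: oscA GAw' _.
  suff -> : G `&` [set w | F w < a] = \bigcup_k (G `&` sval (step k)).
    apply: bigcup_measurable => k _; apply: measurableI => //.
    by case: (step k) => /= B [].
  apply/seteqP; split=> w.
    move=> [Gw /= Fwa]; have d0 : 0 < a - F w by rewrite subr_gt0.
    have [k _ kd] := near_infty_natSinv_lt (PosNum d0).
    exists k => //; split=> //; case: (step k) => /= B [_ _]; apply; split=> //=.
    by rewrite -ltrBrDl; exact: (kd k (leqnn k)).
  by move=> [k _ [Gw]]; case: (step k) => /= B [_ + _] Bw => /(_ _ Bw).
move=> _; apply: (measurability _ (RGenInftyO.measurableE R)) => //.
by move=> _ [_ [a ->] <-]; rewrite set_itvNyo; exact: lower.
Qed.

Lemma measurable_forall_norm_le d (T : measurableType d) (R : realType)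
    (I : countType) (Q : I -> Prop) (g : I -> T -> R) (e : R) :
  (forall i, measurable_fun setT (g i)) ->
  measurable [set w | forall i, Q i -> `|g i w| <= e].
Proof.
move=> mg.
rewrite (_ : [set _ | _] = ~` \bigcup_i
    (if `[< Q i >] then [set w | e < `|g i w|] else set0)).
  apply/measurableC/countable_bigcupT_measurable => [|i]; first exact: countableP.
  case: asboolP => // Qi; rewrite -[X in measurable X]setTI.
  by apply: measurable_fun_ltr => //; exact: measurableT_comp.
apply/seteqP; split=> w /=.
  move=> gw [i _]; case: asboolP => // Qi /=.
  by rewrite ltNge gw.
move=> gw i Qi; rewrite leNgt; apply/negP => gwi; apply: gw.
by exists i => //; case: asboolP.
Qed.

(** * Rational points and boxes in the space of row vectors *)

Lemma rat_in_ball (R : realType) (x e : R) : 0 < e ->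
  exists q : rat, ball x e (ratr q : R).
Proof.
move=> e0; have xB : ball x e !=set0 by exists x; exact: ballxx.
have oB : open (ball x e) by exact: ball_open.
have [z [xz [q _ qz]]] := dense_rat xB oB.
by exists q; rewrite qz.
Qed.

Section rational_points.
Context {R : realType} {m : nat}.
Implicit Types (U : set 'rV[R]_m) (q : 'rV[rat]_m).

Definition rat_point q : 'rV[R]_m := map_mx ratr q.

Definition rat_box q (k : nat) : set 'rV[measurableTypeR R]_m :=
  [set v | forall i, ball (ratr (q ord0 i) : R) k.+1%:R^-1 (v ord0 i)].

Lemma measurable_rat_box q k : measurable (rat_box q k).
Proof.
rewrite (_ : rat_box q k = \bigcap_(i in [set: 'I_m])
    ((fun v : 'rV[measurableTypeR R]_m => v ord0 i) @^-1`
       ball (ratr (q ord0 i) : R) k.+1%:R^-1)).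
  apply: fin_bigcap_measurable => [|i _]; first exact: finite_finset.
  rewrite -[X in measurable X]setTI; apply: measurable_coord_rV => //.
  exact: measurable_ball.
by apply/seteqP; split => v /= Bv i; [move=> _|]; exact: Bv.
Qed.

(** The rational boxes are a countable base of the topology, and they are
    measurable: they transfer openness to the coordinate sigma-algebra. *)
Lemma open_rat_box U v : open U -> U v ->
  exists2 qk, rat_box qk.1 qk.2 v & rat_box qk.1 qk.2 `<=` U.
Proof.
move=> oU Uv.
have /nbhs_ballP[e /= e0 eU] : nbhs v U by exact: open_nbhs_nbhs.
have e20 : 0 < e / 2 by rewrite divr_gt0.
have [k _ /(_ k (leqnn k)) /= ke] := near_infty_natSinv_lt (PosNum e20).
have [q vq] : exists q : 'rV[rat]_m,
    forall i, ball (v ord0 i) k.+1%:R^-1 (ratr (q ord0 i) : R).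
  have /choice[q vq] : forall i, exists q : rat,
      ball (v ord0 i) k.+1%:R^-1 (ratr q : R).
    by move=> i; exact: rat_in_ball.
  by exists (\row_i q i) => i; rewrite mxE.
exists (q, k) => [i|w qw] /=; first exact/ball_sym/vq.
apply: eU; split=> // i j; rewrite ord1.
apply: (@le_ball _ _ _ (k.+1%:R^-1 + k.+1%:R^-1)); first by
  rewrite [leRHS]splitr lerD// ltW.
exact: ball_triangle (vq j) (qw j).
Qed.

Lemma open_measurable_rV (U : set 'rV[measurableTypeR R]_m) :
  open (U : set 'rV[R]_m) -> measurable U.
Proof.
move=> oU; rewrite (_ : U = \bigcup_(qk : 'rV[rat]_m * nat)
    (if `[< rat_box qk.1 qk.2 `<=` U >] then rat_box qk.1 qk.2 else set0)).
  apply: countable_bigcupT_measurable => [|qk]; first exact: countableP.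
  by case: asboolP => // _; exact: measurable_rat_box.
apply/seteqP; split=> v.
  move=> Uv; have [qk qkv qkU] := open_rat_box oU Uv.
  by exists qk => //; case: asboolP.
by move=> [qk _]; case: asboolP => // qkU; exact: qkU.
Qed.

Lemma lebesgue_rV_open_gt0 (U : set 'rV[measurableTypeR R]_m) :
  open (U : set 'rV[R]_m) -> U !=set0 -> (0 < @lebesgue_rV R m U)%E.
Proof.
move=> oU [v Uv]; have [[q k] /= _ qkU] := open_rat_box oU Uv.
apply: (@lt_le_trans _ _ (@lebesgue_rV R m (rat_box q k))); last first.
  by apply: le_measure; rewrite ?inE//;
    [exact: measurable_rat_box|exact: open_measurable_rV].
rewrite /rat_box (lebesgue_rV_box (B := fun i => ball (ratr (q ord0 i) : R) k.+1%:R^-1)).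
  apply: (big_ind (fun x => 0 < x)%E) => // [x y|i _]; first exact: mule_gt0.
  by rewrite lebesgue_measure_ball// lte_fin mulrn_wgt0.
by move=> i; exact: measurable_ball.
Qed.

Lemma closure_rat_point U y (e : R) : open U -> closure U y -> 0 < e ->
  exists q, U (rat_point q) /\ ball y e (rat_point q).
Proof.
move=> oU Uy e0.
have [v [Uv yv]] := Uy _ (nbhsx_ballx y e e0).
have oUe : open (U `&` ball y e) by apply: openI => //; exact: ball_open.
have [[q k] /= _ qkU] := open_rat_box oUe (conj Uv yv).
exists q; apply: qkU => i; rewrite mxE; exact: ballxx.
Qed.

(** Every closure point is near a rational point of [U]; by compactness the codes
    of the rational points needed are bounded. *)
Lemma rational_net U (e : R) : open U -> compact (closure U) -> 0 < e ->
  exists s : seq 'rV[rat]_m, forall y, closure U y ->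
    exists q, [/\ q \in s, U (rat_point q) & ball y e (rat_point q)].
Proof.
move=> oU /compact_near_coveringP cU e0.
have e20 : 0 < e / 2 by rewrite divr_gt0.
have [N _ NU] : \forall N \near \oo, closure U `<=`
    [set y | exists q, [/\ (pickle q <= N)%N, U (rat_point q) & ball y e (rat_point q)]].
  apply: cU => x /(closure_rat_point oU) /(_ e20)[q [Uq xq]].
  near=> x' N => /=; exists q; split=> //.
    by near: N; exact: nbhs_infty_ge.
  rewrite [e]splitr; apply: ball_triangle xq; apply: ball_sym.
  by near: x'; exact: nbhsx_ballx.
exists (pmap unpickle (iota 0 N.+1)) => y /(NU N (leqnn N))[q [qN Uq yq]].
exists q; split=> //; rewrite mem_pmap; apply/mapP; exists (pickle q).
  by rewrite mem_iota.
by rewrite pickleK.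
Unshelve. all: by end_near. Qed.

Lemma continuous_closure_norm_le U (f : 'rV[R]_m -> R) (e : R) : open U ->
  {within closure U, continuous f} ->
  (forall q, U (rat_point q) -> `|f (rat_point q)| <= e) ->
  forall y, closure U y -> `|f y| <= e.
Proof.
move=> oU /subspace_continuousP cf fe y Uy.
apply/ler_addgt0Pr => r r0.
have /cvgrPdist_lt/(_ _ r0) := cf y Uy.
rewrite near_withinE => /nbhs_ballP[c /= c0 fc].
have [q [Uq yq]] := closure_rat_point oU Uy c0.
have := fc _ yq (subset_closure Uq); have := fe _ Uq.
set a := f _; set b := f _; move=> ae ba.
rewrite -[b](subrK a) (le_trans (ler_normD _ _))// addrC lerD//.
exact: ltW.
Qed.

Lemma compact_uniform_continuity (K : set 'rV[R]_m) (f : 'rV[R]_m -> R) (e : R) :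
  compact K -> {within K, continuous f} -> 0 < e ->
  exists p : nat, forall y z, K y -> K z -> ball y p.+1%:R^-1 z ->
    `|f y - f z| <= e.
Proof.
move=> /compact_near_coveringP/near_covering_withinP cK.
move=> /subspace_continuousP cf e0.
have e20 : 0 < e / 2 by rewrite divr_gt0.
have [p _ pK] : \forall p \near \oo, K `<=` [set y |
    forall z, K z -> ball y p.+1%:R^-1 z -> `|f y - f z| <= e].
  apply: cK => x Kx.
  have /cvgrPdist_lt/(_ _ e20) := cf x Kx.
  rewrite near_withinE => /nbhs_ballP[c /= c0 fc].
  have c20 : 0 < c / 2 by rewrite divr_gt0.
  near=> x' p => /= Kx' z Kz x'z.
  have xx' : ball x (c / 2) x' by near: x'; exact: nbhsx_ballx.
  have pc : p.+1%:R^-1 < c / 2 by near: p; exact: (near_infty_natSinv_lt (PosNum c20)).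
  have xz : ball x c z.
    by rewrite [c]splitr; apply: ball_triangle xx' _; apply: le_ball x'z; exact: ltW.
  have xx'c : ball x c x' by apply: le_ball xx'; rewrite ler_pdivrMr//; lra.
  rewrite -(subrKA (f x)) (le_trans (ler_normD _ _))// [leRHS]splitr.
  by rewrite lerD// ltW//; [rewrite distrC|]; exact: fc.
by exists p => y z Ky Kz; exact: (pK p (leqnn p) y Ky z Kz).
Unshelve. all: by end_near. Qed.

End rational_points.

(** A piece of the cover collects the realizations whose path varies by at most
    [c] at scale [1 / (p + 1)] and takes prescribed rational values, up to [c],
    on a finite net of that mesh. Only rational points enter, so each piece is a
    countable intersection of events; uniform continuity puts every path in one
    of them, and two paths of the same piece differ by at most [4 * c]. *)
Lemma measurable_fun_path_lipschitz d (T : measurableType d) (R : realType)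
    (m : nat) (U : set 'rV[R]_m) (X : 'rV[R]_m -> T -> R) (G : set T)
    (F : T -> R) (C : R) :
  open U -> compact (closure U) ->
  (forall y, measurable_fun setT (X y)) -> measurable G ->
  (forall w, G w -> {within closure U, continuous (fun y => X y w)}) ->
  0 <= C ->
  (forall w w' e, G w -> G w' ->
     (forall y, closure U y -> `|X y w - X y w'| <= e) -> F w <= F w' + C * e) ->
  measurable_fun G F.
Proof.
move=> oU cU mX mG cX C0 FX; apply: measurable_fun_small_oscillation => // e e0.
pose c := e / (4 * (C + 1)).
have c0 : 0 < c by rewrite divr_gt0// mulr_gt0// ltr_wpDl.
have Cce : C * (4 * c) <= e.
  rewrite -[leRHS](mulfVK (_ : 4 * (C + 1) != 0)).
    by rewrite -/c; nra.
  by rewrite mulf_neq0// gt_eqF// ltr_wpDl.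
have /choice[s sP] : forall p : nat, exists s : seq 'rV[rat]_m,
    forall y, closure U y -> exists q,
      [/\ q \in s, U (rat_point q) & ball y (p.+1%:R^-1 : R) (rat_point q)].
  by move=> p; exact: rational_net.
(* The pieces are indexed by the scale [p] and the list of prescribed values,
   in the order of the net [s p]. *)
pose osc (p : nat) : set T := [set w | forall qq : 'rV[rat]_m * 'rV[rat]_m,
  [/\ U (rat_point qq.1), U (rat_point qq.2) &
      ball (rat_point qq.1) (p.+1%:R^-1 : R) (rat_point qq.2)] ->
  `|X (rat_point qq.1) w - X (rat_point qq.2) w| <= c].
pose val (p : nat) (v : seq rat) : set T := [set w | forall q : 'rV[rat]_m,
  q \in s p -> `|X (rat_point q) w - ratr v`_(index q (s p))| <= c].
exists (nat * seq rat)%type, (fun i => osc i.1 `&` val i.1 i.2); split.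
- move=> [p v]; apply: measurableI; apply: measurable_forall_norm_le => i.
    exact: measurable_funB.
  exact: measurable_funB.
- move=> w Gw; have [p pP] := compact_uniform_continuity cU (cX _ Gw) c0.
  have /choice[a aP] : forall q : 'rV[rat]_m, exists a : rat,
      `|X (rat_point q) w - ratr a| <= c.
    move=> q; have [a aP] := rat_in_ball (X (rat_point q) w) c0.
    by exists a; exact: ltW.
  exists (p, map a (s p)) => //; split=> /=.
    by move=> qq [U1 U2 qq12]; apply: pP => //; exact: subset_closure.
  by move=> q qs; rewrite (nth_map 0) ?index_mem// nth_index.
- move=> [p v] w w' [Gw [/= ow vw]] [Gw' [/= ow' vw']].
  apply: le_trans (FX w w' (4 * c) Gw Gw' _) _; last by rewrite lerD2l.
  apply: continuous_closure_norm_le => //.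
    move=> y; apply: continuousB; [exact: cX|exact: cX].
  move=> q Uq; have [q' [q's Uq' qq']] := sP p _ (subset_closure Uq).
  have := ow (q, q') (And3 Uq Uq' qq'); have := ow' (q, q') (And3 Uq Uq' qq').
  have := vw _ q's; have := vw' _ q's => /=; rewrite !ler_distl.
  by move=> /andP[? ?] /andP[? ?] /andP[? ?] /andP[? ?]; apply/andP; split; lra.
Qed.

(** * Comparison of principal eigenvalues *)

Section comparison.
Context {R : realType} {m : nat}.
Variable Omega : set 'rV[measurableTypeR R]_m.
Hypothesis mOmega : measurable Omega.
Local Notation leb := (@lebesgue_rV R m).

Lemma L2_mul_integrable (f g : 'rV[R]_m -> R) : L2 Omega f -> L2 Omega g ->
  leb.-integrable Omega (EFin \o (fun y => f y * g y)).
Proof.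
move=> [mf f2] [mg g2].
have sq (h : 'rV[R]_m -> R) : L2 Omega h ->
    leb.-integrable Omega (EFin \o (fun y => h y ^+ 2)).
  move=> [mh h2]; apply/integrableP; split.
    by apply/measurable_EFinP; exact: measurable_funX.
  by under eq_integral do rewrite /= ger0_norm ?sqr_ge0//.
apply: (le_integrable mOmega _ _
  (integrableD mOmega (sq _ (conj mf f2)) (sq _ (conj mg g2)))).
  by apply/measurable_EFinP; exact: measurable_funM.
move=> y _ /=; rewrite lee_fin [leRHS]ger0_norm ?addr_ge0 ?sqr_ge0//.
by rewrite normrM -(real_normK (num_real (f y))) -(real_normK (num_real (g y))); nra.
Qed.

(** Otherwise [(mu1 - mu2 - (V1 - V2)) * p1 * p2] would be positive on [Omega],
    although its integral vanishes: testing each equation with the solution of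
    the other produces the same integral of [G1 . G2]. *)
Lemma principal_eigenvalue_le (V1 V2 : 'rV[R]_m -> R) (mu1 mu2 r : R) :
  (0 < leb Omega)%E ->
  principal_eigenvalue Omega V1 mu1 -> principal_eigenvalue Omega V2 mu2 ->
  (forall y, Omega y -> V1 y - V2 y <= r) -> mu1 - mu2 <= r.
Proof.
move=> Omega0 [p1 p1_gt0 [h1 [G1 H1p1 w1]]] [p2 p2_gt0 [h2 [G2 H1p2 w2]]] Vr.
rewrite leNgt; apply/negP => rmu.
have int1 := L2_mul_integrable h1 H1p2.1.
have int2 := L2_mul_integrable h2 H1p1.1.
have : \int[leb]_(y in Omega) ((mu1 * p1 y - V1 y * p1 y) * p2 y -
    (mu2 * p2 y - V2 y * p2 y) * p1 y) = 0.
  rewrite RintegralB// (w1 _ _ H1p2) (w2 _ _ H1p1).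
  by under eq_Rintegral do under eq_bigr do rewrite mulrC; rewrite subrr.
set D := fun y => _ - _; move=> D0.
have iD : leb.-integrable Omega (EFin \o D) by exact: (integrableB mOmega int1 int2).
have D_gt0 y : Omega y -> 0 < D y.
  move=> Oy; rewrite (_ : D y = (mu1 - mu2 - (V1 y - V2 y)) * (p1 y * p2 y)).
    by rewrite mulr_gt0 ?mulr_gt0 ?p1_gt0 ?p2_gt0// subr_gt0 (le_lt_trans (Vr _ Oy)).
  by rewrite /D; ring.
have D0' : (\int[leb]_(y in Omega) `|(EFin \o D) y| = 0)%E.
  rewrite (eq_integral (EFin \o D)); last first.
    by move=> y /set_mem Oy /=; rewrite gtr0_norm ?D_gt0.
  rewrite -(fineK (integrable_fin_num mOmega iD)); congr EFin; exact: D0.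
have /integrableP[mD _] := iD.
have [N [mN N0 subN]] := (ae_eq_integral_abs leb mOmega mD).1 D0'.
have : (leb Omega <= leb N)%E.
  apply: le_measure; rewrite ?inE// => y Oy; apply: subN => /= /(_ Oy) [Dy].
  by have := D_gt0 _ Oy; rewrite Dy ltxx.
by rewrite N0 leNgt Omega0.
Qed.

End comparison.

(** * The speed for a fixed realization *)

Section deterministic_front_speed.
Context {R : realType}.

Definition shear_potential {m} (lambda delta : R) (beta : 'rV[R]_m -> R) y :=
  lambda ^+ 2 + lambda * delta * beta y + derive1 kpp 0.

Lemma front_speed_dist_le (mu1 mu2 : R -> R) (L : R) :
  (forall lambda, 0 < lambda -> `|mu1 lambda - mu2 lambda| <= lambda * L) ->
  `|front_speed mu1 - front_speed mu2| <= L.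
Proof.
move=> muL; apply: dist_inf_image_le => [|l /= l0]; first by exists 1 => /=.
by rewrite -mulrBl normrM normfV (gtr0_norm l0) ler_pdivrMr// mulrC muL.
Qed.

(** Amplitudes are allowed to differ so that [delta2 = 0] compares a shear with
    no shear at all. *)
Lemma eigenvalue_dist_le {m} (Omega : set 'rV[R]_m)
    (lambda delta1 delta2 L mu1 mu2 : R) (beta1 beta2 : 'rV[R]_m -> R) :
  open Omega -> Omega !=set0 -> 0 < lambda ->
  (forall y, Omega y -> `|delta1 * beta1 y - delta2 * beta2 y| <= L) ->
  principal_eigenvalue Omega (shear_potential lambda delta1 beta1) mu1 ->
  principal_eigenvalue Omega (shear_potential lambda delta2 beta2) mu2 ->
  `|mu1 - mu2| <= lambda * L.
Proof.
move=> oO O0 l0 bL e1 e2.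
have mO := open_measurable_rV oO; have O_gt0 := lebesgue_rV_open_gt0 oO O0.
rewrite ler_norml lerNl opprB; apply/andP; split.
  apply: (principal_eigenvalue_le mO O_gt0 e2 e1) => y /bL.
  by rewrite ler_norml /shear_potential => /andP[? ?]; nra.
apply: (principal_eigenvalue_le mO O_gt0 e1 e2) => y /bL.
by rewrite ler_norml /shear_potential => /andP[? ?]; nra.
Qed.

(** In the variable [s = lambda * delta] the shear enters the potential through
    [s * beta] only, so that [mu lambda delta - lambda ^+ 2] depends on [s]
    alone; [mu s 1 - s ^+ 2] is its value computed at [delta = 1]. *)
Lemma front_speed_rescaled {m} (Omega : set 'rV[R]_m) (beta : 'rV[R]_m -> R)
    (mu : R -> R -> R) :
  open Omega -> Omega !=set0 ->
  (forall lambda delta, 0 < lambda -> 0 <= delta ->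
     principal_eigenvalue Omega (shear_potential lambda delta beta)
       (mu lambda delta)) ->
  forall delta, 0 < delta ->
  delta^-1 * front_speed (mu ^~ delta) =
  inf [set s / delta ^+ 2 + (mu s 1 - s ^+ 2) / s | s in [set s | 0 < s]].
Proof.
move=> oO O0 muE delta d0.
have mO := open_measurable_rV oO; have O_gt0 := lebesgue_rV_open_gt0 oO O0.
rewrite /front_speed -inf_image_pM ?invr_gt0//; last by exists 1 => /=.
have scal s : 0 < s ->
    mu (s / delta) delta - (s / delta) ^+ 2 = mu s 1 - s ^+ 2.
  move=> s0; have sd0 : 0 < s / delta by rewrite divr_gt0.
  have e1 := muE _ _ sd0 (ltW d0); have e2 := muE _ _ s0 ler01.
  have sdd : s / delta * delta = s by rewrite divfK// gt_eqF.
  apply/eqP; rewrite eq_le; apply/andP; split.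
    rewrite lerBlDr -addrA -lerBlDl addrC.
    apply: (principal_eigenvalue_le mO O_gt0 e1 e2) => y _.
    by rewrite /shear_potential sdd; lra.
  rewrite lerBlDr -addrA -lerBlDl addrC.
  apply: (principal_eigenvalue_le mO O_gt0 e2 e1) => y _.
  by rewrite /shear_potential sdd; lra.
congr inf; apply/seteqP; split=> _ [s /= s0 <-].
  exists (s * delta); first by rewrite /= mulr_gt0.
  rewrite -scal ?mulr_gt0// mulfK ?gt_eqF//; field.
  by rewrite !gt_eqF.
exists (s / delta); first by rewrite /= divr_gt0.
rewrite -scal//; field.
by rewrite !gt_eqF.
Qed.

End deterministic_front_speed.

(** * Passing to the limit in the expectation *)

(** A limit at infinity can be tested on sequences [u], which makes dominated
    convergence available for a real parameter. The functions [c t] may be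
    arbitrary on the null set [N]. *)
Lemma cvg_expectation_ratio d (T : measurableType d) (R : realType)
    (P : probability T R) (N : set T) (c : R -> T -> R) (a : R) (B : T -> R) :
  measurable N -> P N = 0%E ->
  P.-integrable (~` N) (EFin \o B) ->
  (forall t, 1 <= t -> measurable_fun (~` N) (c t)) ->
  (forall t w, 1 <= t -> (~` N) w -> `|c t w| <= a + t * B w) ->
  (forall w, (~` N) w -> exists l : R, t^-1 * c t w @[t --> +oo] --> l) ->
  exists l : R, ('E_P[fun w => `|c t w|%R] * (t^-1)%:E)%E @[t --> +oo] --> l%:E.
Proof.
move=> mN N0 iB mc cB lim.
have mG : measurable (~` N) by exact: measurableC.
have /choice[g gP] : forall w, exists l : R,
    (~` N) w -> t^-1 * c t w @[t --> +oo] --> l.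
  move=> w; have [Gw|nGw] := pselect ((~` N) w); last by exists 0.
  by have [l ?] := lim _ Gw; exists l.
(* Domination is available for [t >= 1] only, whence the truncation of the
   sequence at 1, which is invisible in the limit. *)
pose r (u : nat -> R) n w := (Num.max (u n) 1)^-1 * c (Num.max (u n) 1) w.
have max1 (x : R) : 1 <= Num.max x 1 by rewrite le_max lexx orbT.
have mr u n : measurable_fun (~` N) (r u n).
  by apply: measurable_funM => //; exact: mc.
have rg u : u n @[n --> \oo] --> +oo ->
    forall w, (~` N) w -> r u n w @[n --> \oo] --> g w.
  move=> uoo w Gw; have := cvg_comp _ _ uoo (gP _ Gw); apply: cvg_trans.
  apply: near_eq_cvg; near=> n; rewrite /r max_l//.
  by near: n; move/cvgryPge : uoo; exact.
have nat_oo : (n%:R : R) @[n --> \oo] --> +oo by exact: cvgr_idn.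
have mg : measurable_fun (~` N) g.
  exact: (measurable_fun_cvg (mr (fun n => n%:R)) (rg _ nat_oo)).
have idom : P.-integrable (~` N) (EFin \o (fun w => `|a| + `|B w|)).
  have := integrableD mG (finite_measure_integrable_cst P `|a| mG)
    (integrable_norm iB).
  by [].
have rdom u n w : (~` N) w -> `|r u n w| <= `|a| + `|B w|.
  move=> Gw; set t := Num.max (u n) 1; have t1 : 1 <= t by exact: max1.
  have t0 : 0 < t by lra.
  rewrite /r -/t normrM normfV (gtr0_norm t0) ler_pdivrMl//.
  apply: le_trans (cB _ _ t1 Gw) _.
  rewrite mulrDr lerD//; last by rewrite ler_pM2l// ler_norm.
  by rewrite (le_trans (ler_norm a))// ler_peMl.
have DCT u : u n @[n --> \oo] --> +oo ->
   P.-integrable (~` N) (EFin \o (fun w => `|g w|)) /\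
   (\int[P]_(w in ~` N) `|r u n w|%:E)%E @[n --> \oo] -->
     (\int[P]_(w in ~` N) `|g w|%:E)%E.
  move=> uoo; have [] := @dominated_convergence _ _ _ P (~` N) mG
    (fun n w => `|r u n w|%:E) (fun w => `|g w|%:E)
    (EFin \o (fun w => `|a| + `|B w|)) => //.
  - by move=> n; apply/measurable_EFinP; exact: measurableT_comp.
  - by apply/measurable_EFinP; exact: measurableT_comp.
  - by apply: aeW => w Gw; apply: cvg_EFin; [exact: nearW|apply: cvg_norm; exact: rg].
  - by apply: aeW => w n Gw; rewrite /= lee_fin normr_id; exact: rdom.
have [ig _] := DCT _ nat_oo.
exists (fine (\int[P]_(w in ~` N) `|g w|%:E)).
rewrite fineK ?integrable_fin_num//.
apply/cvge_pinftyP => u uoo; have [_] := DCT _ uoo; apply: cvg_trans.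
apply: near_eq_cvg; near=> n.
have un1 : 1 <= u n by near: n; move/cvgryPge : uoo; exact.
have un0 : 0 < u n by lra.
rewrite expectation.unlock (ge0_integral_null_setC mN N0)//.
rewrite muleC -ge0_integralZl//.
- apply: eq_integral => w _; rewrite /r max_l// normrM normfV (gtr0_norm un0).
  by rewrite EFinM.
- by apply/measurable_EFinP; apply: measurableT_comp => //; exact: mc.
- by rewrite lee_fin invr_ge0 ltW.
Unshelve. all: by end_near. Qed.

(** * The random front speed *)

Lemma compact_closure_bounded (R : realType) (m : nat) (A : set 'rV[R]_m) :
  bounded_set A -> compact (closure A).
Proof.
move=> [M [Mr AM]]; apply: bounded_closed_compact; last exact: closed_closure.
exists M; split=> // x Mx y Ay /=.
have cl : closed [set z : 'rV[R]_m | `|z| <= x].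
  rewrite (_ : [set _ | _] = Num.norm @^-1` [set r : R | r <= x])//.
  by apply: preimage_closed; [move=> z _; exact: norm_continuous|exact: closed_le].
have AC : A `<=` [set z | `|z| <= x] by move=> z Az; exact: AM Mx _ Az.
by have := closure_subset AC Ay; rewrite -(closure_id _).1.
Qed.

Section sup_norm_lemmas.
Context {R : realType} {d : measure_display} {T : measurableType d}.
Context {P : probability T R} {m : nat}.
Variables (K : set 'rV[R]_m) (b : 'rV[R]_m -> {RV P >-> R}).

Lemma sup_norm_fin_num w : K !=set0 -> compact K -> continuous_path K b w ->
  sup_norm K b w \is a fin_num.
Proof.
move=> [y0 Ky0] cK cb.
have [M [Mr bM]] := compact_bounded (continuous_compact cb cK).
have leM : (sup_norm K b w <= (M + 1)%:E)%E.
  apply: ge_ereal_sup => _ [y Ky <-]; rewrite lee_fin.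
  by apply: (bM (M + 1)); [rewrite ltrDl|exists y].
rewrite fin_numE -ltNye -ltey (le_lt_trans leM) ?ltry// andbT.
apply: (@lt_le_trans _ _ (`|b y0 w|%:E)); first exact: ltNyr.
by apply: ereal_sup_ubound; exists y0.
Qed.

Lemma norm_le_sup_norm w y : sup_norm K b w \is a fin_num -> K y ->
  `|b y w| <= fine (sup_norm K b w).
Proof.
move=> fin Ky; rewrite -lee_fin fineK//.
by apply: ereal_sup_ubound; exists y.
Qed.

Lemma sup_norm_le w (M : R) : sup_norm K b w \is a fin_num ->
  (forall y, K y -> `|b y w| <= M) -> fine (sup_norm K b w) <= M.
Proof.
move=> fin bM; rewrite -lee_fin fineK//.
by apply: ge_ereal_sup => _ [y Ky <-]; rewrite lee_fin bM.
Qed.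

End sup_norm_lemmas.

Theorem theorem2p2 (R : realType) (n : nat) (Omega : set 'rV[R]_n.-1)
    (d : measure_display) (T : measurableType d) (P : probability T R)
    (b : 'rV[R]_n.-1 -> {RV P >-> R}) (mu : R -> R -> T -> R) :
  (2 <= n)%N ->
  domain Omega -> bounded_set Omega ->
  simply_connected Omega -> smooth_boundary Omega ->
  stationary (closure Omega) b ->
  {ae P, forall w, continuous_path (closure Omega) b w} ->
  (\int[P]_w sup_norm (closure Omega) b w < +oo)%E ->
  (forall w, continuous_path (closure Omega) b w ->
   forall lambda delta, 0 < lambda -> 0 <= delta ->
     principal_eigenvalue Omega
       (fun y => lambda ^+ 2 + lambda * delta * b y w + derive1 kpp 0)
       (mu lambda delta w)) ->
  let cstar delta w := front_speed (fun lambda => mu lambda delta w) in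
  (exists C : R, \forall delta \near +oo,
     ('E_P[fun w => `|cstar delta w|%R] <= (C * delta)%:E)%E) /\
  (exists l : R,
     ('E_P[fun w => `|cstar delta w|%R] * (delta^-1)%:E)%E
       @[delta --> +oo] --> l%:E).
Proof.
move=> _ [neO oO _] bO _ _ _ [N [mN N0 subN]] ib muE cstar.
set K := closure Omega in ib subN muE *.
have cK : compact K by exact: compact_closure_bounded.
have K0 : K !=set0 by case: neO => y Oy; exists y; exact: subset_closure.
have OK : Omega `<=` K by exact: subset_closure.
have mG : measurable (~` N) by exact: measurableC.
have cG w : (~` N) w -> continuous_path K b w.
  by move=> Nw; apply: contrapT => ncw; apply/Nw/subN.
(* A reference realization: the speed at [delta = 0] is the same for all. *)
have [w0 Gw0] : ~` N !=set0.
  apply/set0P/eqP => /(congr1 (fun A => P (~` A))).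
  rewrite setCK setC0 probability_setT N0 => /eqP.
  by rewrite eq_sym onee_eq0.
pose B w := fine (sup_norm K b w).
have finB w : (~` N) w -> sup_norm K b w \is a fin_num.
  by move=> Gw; apply: sup_norm_fin_num => //; exact: cG.
have bB w y : (~` N) w -> K y -> `|b y w| <= B w.
  by move=> Gw; apply: norm_le_sup_norm; exact: finB.
have eig w : (~` N) w -> forall lambda delta, 0 < lambda -> 0 <= delta ->
    principal_eigenvalue Omega (shear_potential lambda delta (fun y => b y w))
      (mu lambda delta w).
  by move=> /cG; exact: muE.
have cdist d1 d2 w w' L : (~` N) w -> (~` N) w' -> 0 <= d1 -> 0 <= d2 ->
    (forall y, K y -> `|d1 * b y w - d2 * b y w'| <= L) ->
    `|cstar d1 w - cstar d2 w'| <= L.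
  move=> Gw Gw' d10 d20 bL; apply: front_speed_dist_le => l l0.
  apply: (eigenvalue_dist_le oO neO l0 _ (eig _ Gw _ _ l0 d10) (eig _ Gw' _ _ l0 d20)).
  by move=> y /OK; exact: bL.
have mb y : measurable_fun setT (b y) by [].
have mc t : 1 <= t -> measurable_fun (~` N) (cstar t).
  move=> t1; have t0 : 0 <= t by lra.
  apply: (measurable_fun_path_lipschitz oO cK mb mG cG t0) => w w' e Gw Gw' be.
  have : `|cstar t w - cstar t w'| <= t * e.
    apply: cdist => // y Ky; rewrite -mulrBr normrM ger0_norm//.
    by rewrite ler_wpM2l// be.
  by rewrite ler_distl => /andP[_]; rewrite addrC.
(* The sup norm is itself 1-Lipschitz in the path. *)
have mB : measurable_fun (~` N) B.
  apply: (measurable_fun_path_lipschitz oO cK mb mG cG ler01) => w w' e Gw Gw' be.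
  apply: sup_norm_le; first exact: finB.
  move=> y Ky; rewrite mul1r -[b y w](subrK (b y w')) addrC.
  by rewrite (le_trans (ler_normD _ _))// lerD ?bB ?be.
have B0 w : 0 <= B w.
  apply: fine_ge0; case: K0 => y Ky.
  by apply: le_ereal_sup_tmp; exists (`|b y w|%:E); [exists y|rewrite lee_fin].
have iB : P.-integrable (~` N) (EFin \o B).
  apply/integrableP; split; first exact/measurable_EFinP.
  apply: le_lt_trans ib; rewrite [leRHS](ge0_integral_null_setC mN N0); last first.
    by move=> w; case: K0 => y Ky; apply: le_ereal_sup_tmp;
      exists (`|b y w|%:E); [exists y|rewrite lee_fin].
  rewrite (eq_integral (sup_norm K b))// => w /set_mem Gw /=.
  by rewrite ger0_norm// fineK// finB.
pose a := `|cstar 0 w0|.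
have cB t w : 1 <= t -> (~` N) w -> `|cstar t w| <= a + t * B w.
  move=> t1 Gw; have t0 : 0 <= t by lra.
  rewrite -[cstar t w](subrK (cstar 0 w0)) addrC (le_trans (ler_normD _ _))//.
  rewrite lerD2l; apply: cdist => // y Ky.
  by rewrite mul0r subr0 normrM ger0_norm// ler_wpM2l// bB.
have lim w : (~` N) w -> exists l : R, t^-1 * cstar t w @[t --> +oo] --> l.
  move=> Gw; pose k s := (mu s 1 w - s ^+ 2) / s.
  have cE t : 1 <= t -> t^-1 * cstar t w =
      inf [set s / t ^+ 2 + k s | s in [set s | 0 < s]].
    move=> t1; have t0 : 0 < t by lra.
    exact: (front_speed_rescaled oO neO (eig _ Gw) t0).
  have [|l kl] := @cvg_inf_penalized _ k (a + B w).
    move=> t t1; rewrite -cE// normrM normfV (gtr0_norm (_ : 0 < t)); last by lra.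
    rewrite ler_pdivrMl; last by lra.
    apply: le_trans (cB _ _ t1 Gw) _.
    by rewrite mulrDr lerD2r ler_peMl ?normr_ge0.
  exists l; apply: cvg_trans kl; apply: near_eq_cvg; near=> t.
  by rewrite cE//; near: t; apply: nbhs_pinfty_ge; rewrite num_real.
have [l El] := cvg_expectation_ratio mN N0 iB mc cB lim.
split; last by exists l.
exists (l + 1).
move/fine_cvgP : El => [Efin El].
near=> t.
have t0 : 0 < t by near: t; apply: nbhs_pinfty_gt; rewrite num_real.
rewrite EFinM -lee_pdivrMr//.
have fint : ('E_P[fun w => `|cstar t w|%R] * (t^-1)%:E)%E \is a fin_num.
  by near: t.
rewrite -(fineK fint) lee_fin.
by near: t; apply: (cvgr_le _ El); rewrite ltrDl.
Unshelve. all: by end_near. Qed.
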